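(* Let $\pi\colon\Gamma\to\Gamma'$ be a morphism of $X$-graphs, let $v\in V(\Gamma)$ and $v'=\pi(v)$. Let $G=\langle X\mid R\rangle$ be a group with $X$ finite and $R$ not necessarily finite, with canonical epimorphism $\phi\colon F(X)\to G$. Suppose that $\Gamma$ and $\Gamma'$ are connected finite $X$-regular graphs which fulfill the defining relators $R$. Put $K=L(\Gamma,v)$ and $H=L(\Gamma',v')$. Then $\phi(K)\le\phi(H)\le G$.
   Context: $F(X)$ is the free group on $X$, realized as the set of freely reduced words in $X\cup X^{-1}$; $R\subseteq F(X)$; $G\cong F(X)/\langle\!\langle R\rangle\!\rangle_{F(X)}$ and $\phi\colon F(X)\to G$ is the canonical epimorphism. An $X$-graph is a directed graph $\Gamma$ (loops and multiple edges allowed) in which every directed edge $e$, with origin $o(e)$ and terminus $t(e)$, carries a label $\mu(e)\in X$. A morphism of $X$-graphs maps vertices to vertices and directed edges to directed edges, preserving labels, origins and termini. $\widehat\Gamma$ is obtained from $\Gamma$ by adding, for each edge $e$, a formal inverse $e^{-1}$ with $o(e^{-1})=t(e)$, $t(e^{-1})=o(e)$, $\mu(e^{-1})=\mu(e)^{-1}$ (and $(e^{-1})^{-1}=e$). A path $p$ in $\Gamma$ is a sequence $e_1,\dots,e_k$ of edges of $\widehat\Gamma$ with $o(e_i)=t(e_{i-1})$; $o(p)=o(e_1)$, $t(p)=t(e_k)$, $\mu(p)=\mu(e_1)\cdots\mu(e_k)$; a single vertex is also a path, with empty label. A path is reduced if it has no subpath $e,e^{-1}$ with $e$ an edge of $\widehat\Gamma$.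 The language is $L(\Gamma,v)=\{\mu(p)\mid p$ a reduced path in $\Gamma$ with $o(p)=t(p)=v\}$. $\Gamma$ is $X$-regular if for every vertex $v$ and every $x\in X\cup X^{-1}$ there is exactly one edge in $\widehat\Gamma$ with origin $v$ and label $x$ (then $L(\Gamma,v)$ is a subgroup of $F(X)$). $\Gamma$ fulfills the defining relators $R$ if for every vertex $v$ and every $r\in R$, each reduced path with origin $v$ and label $r$ has terminus $v$. *)

(* Defs.v *)
From HB Require Import structures.
From mathcomp Require Import all_boot.
From mathcomp Require Import boolp classical_sets functions cardinality.

Set Implicit Arguments.
Unset Strict Implicit.
Unset Printing Implicit Defensive.

Local Open Scope classical_set_scope.

(* X u X^-1: (x, false) stands for x and (x, true) for x^-1. *)
Definition letter (X : Type) : Type := (X * bool)%type.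

Definition linv {X : Type} (a : letter X) : letter X := (a.1, ~~ a.2).

Section FreeGroup.
Variable X : choiceType.
Implicit Types (a b : X * bool) (u v w : seq (X * bool)).

Definition freely_reduced w : bool := sorted (fun a b => b != linv a) w.

(* Left multiplication of a reduced word by one letter. *)
Definition push a w :=
  if w is b :: w' then if b == linv a then w' else a :: w else [:: a].

Definition act u w := foldr push w u.

Definition free_reduce w := act w [::].

Definition winv w := rev (map linv w).

Lemma linvK : involutive (@linv X).
Proof. by case=> x e; rewrite /linv /= negbK. Qed.

Lemma freely_reduced_behead a w : freely_reduced (a :: w) -> freely_reduced w.
Proof. exact: path_sorted. Qed.

Lemma push_reduced a w : freely_reduced w -> freely_reduced (push a w).
Proof.
case: w => [//|b w] rw /=; case: eqP => [_|/eqP ne].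
  exact: freely_reduced_behead rw.
by rewrite /freely_reduced /= ne.
Qed.

Lemma pushK a w : freely_reduced w -> push a (push (linv a) w) = w.
Proof.
case: w => [|b w] rw /=; first by rewrite eqxx.
rewrite linvK; case: eqP => [ba|_]; last by rewrite /= eqxx.
subst b; case: w rw => [//|c w] /= /andP[/negbTE ne _].
by rewrite ne.
Qed.

Lemma act_reduced u w : freely_reduced w -> freely_reduced (act u w).
Proof. by move=> rw; elim: u => //= a u; exact: push_reduced. Qed.

Lemma free_reduceP w : freely_reduced (free_reduce w).
Proof. exact: act_reduced. Qed.

Lemma free_reduce_id w : freely_reduced w -> free_reduce w = w.
Proof.
elim: w => //= a w IH raw.
rewrite /free_reduce /= -/(free_reduce w) (IH (freely_reduced_behead raw)).
case: w raw {IH} => [//|b w] /= /andP[/negbTE ne _].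
by rewrite ne.
Qed.

Lemma act_push a u w :
  freely_reduced w -> act (push a u) w = push a (act u w).
Proof.
move=> rw; case: u => [//|b u] /=; case: eqP => [->|//].
by rewrite pushK //; exact: act_reduced.
Qed.

Lemma act_free_reduce u w :
  freely_reduced w -> act (free_reduce u) w = act u w.
Proof.
move=> rw; elim: u => //= a u IH.
by rewrite /free_reduce /= -/(free_reduce u) act_push // IH.
Qed.

Lemma act_cat u v w : act (u ++ v) w = act u (act v w).
Proof. exact: foldr_cat. Qed.

Lemma free_reduce_cat u v : free_reduce (u ++ v) = act u (free_reduce v).
Proof. exact: act_cat. Qed.

Lemma winv_reduced w : freely_reduced w -> freely_reduced (winv w).
Proof.
move=> rw; rewrite /freely_reduced /winv rev_sorted sorted_map.
apply: sub_sorted rw => a b /=; rewrite linvK; apply: contra => /eqP ->.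
by [].
Qed.

Lemma act_winv w : act (winv w) w = [::].
Proof.
elim: w => //= a w IH; rewrite /winv /= rev_cons -cats1 act_cat /=.
by rewrite linvK eqxx.
Qed.

Record free_group := FreeGroup {
  fword :> seq (X * bool);
  _ : freely_reduced fword
}.

HB.instance Definition _ := [isSub for fword].
HB.instance Definition _ := [Choice of free_group by <:].

Definition fg_one : free_group := @FreeGroup [::] isT.

Definition fg_mul (g h : free_group) : free_group :=
  FreeGroup (free_reduceP (fword g ++ fword h)).

Definition fg_inv (g : free_group) : free_group :=
  FreeGroup (winv_reduced (valP g)).

Lemma fg_mulA : associative fg_mul.
Proof.
move=> g h k; apply: val_inj; rewrite /= free_reduce_cat.
rewrite [RHS]free_reduce_cat act_free_reduce; last exact: free_reduceP.
by rewrite free_reduce_id ?free_reduceP // free_reduce_cat act_cat.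
Qed.

Lemma fg_mul1 : left_id fg_one fg_mul.
Proof. by move=> g; apply: val_inj; exact/free_reduce_id/valP. Qed.

Lemma fg_mulr1 : right_id fg_one fg_mul.
Proof.
by move=> g; apply: val_inj; rewrite /= cats0; exact/free_reduce_id/valP.
Qed.

Lemma fg_mulV : left_inverse fg_one fg_inv fg_mul.
Proof.
move=> g; apply: val_inj; rewrite /= free_reduce_cat.
by rewrite free_reduce_id ?act_winv //; exact: valP.
Qed.

Lemma fg_mulVr : right_inverse fg_one fg_inv fg_mul.
Proof.
move=> g; have invK : fg_inv (fg_inv g) = g.
  apply: val_inj; rewrite /= /winv map_rev revK -map_comp.
  by rewrite (eq_map (g := id)) ?map_id // => a; exact: linvK.
by rewrite -{1}invK fg_mulV.
Qed.

End FreeGroup.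

HB.instance Definition _ (X : choiceType) :=
  isGroup.Build (free_group X)
    (@fg_mulA X) (@fg_mul1 X) (@fg_mulr1 X) (@fg_mulV X) (@fg_mulVr X).

Section Presentations.
Local Open Scope group_scope.

Definition subgroup (G : groupType) (A : set G) : Prop := group_closed [in A].

Definition normal_subgroup (G : groupType) (A : set G) : Prop :=
  subgroup A /\ forall g x : G, A x -> A (x ^ g).

Definition normal_closure (G : groupType) (R : set G) : set G :=
  smallest (@normal_subgroup G) R.

(* G = <X | R>, with phi : F(X) -> G as its canonical epimorphism. *)
Definition presentation (X : choiceType) (R : set (free_group X))
    (G : groupType) (phi : {multiplicative free_group X -> G}) : Prop :=
  range phi = setT /\ phi @^-1` [set 1] = normal_closure R.

End Presentations.

Record xgraph (X : Type) := XGraph {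
  vertex : Type;
  edge : Type;
  org : edge -> vertex;
  ter : edge -> vertex;
  lab : edge -> X
}.

Record xmorphism (X : Type) (Gam Gam' : xgraph X) := XMorphism {
  vmap :> vertex Gam -> vertex Gam';
  emap : edge Gam -> edge Gam';
  emap_org : forall e, org (emap e) = vmap (org e);
  emap_ter : forall e, ter (emap e) = vmap (ter e);
  emap_lab : forall e, lab (emap e) = lab e
}.

Section Graphs.
Variables (X : choiceType) (Gam : xgraph X).

(* Edges of the graph with formal inverses: (e, false) is e, (e, true) is its
   formal inverse. *)
Definition hedge : Type := (edge Gam * bool)%type.

Definition hinv (e : hedge) : hedge := (e.1, ~~ e.2).
Definition horg (e : hedge) : vertex Gam := if e.2 then ter e.1 else org e.1.
Definition hter (e : hedge) : vertex Gam := if e.2 then org e.1 else ter e.1.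
Definition hlab (e : hedge) : letter X := (lab e.1, e.2).

(* p is a path with origin u and terminus v; p = [::] is the path consisting of
   the single vertex u. *)
Fixpoint is_path (u : vertex Gam) (p : seq hedge) (v : vertex Gam) : Prop :=
  if p is e :: p' then horg e = u /\ is_path (hter e) p' v else u = v.

Definition plab (p : seq hedge) : seq (letter X) := map hlab p.

Definition reduced_path (p : seq hedge) : Prop :=
  ~ exists (p1 : seq hedge) (e : hedge) (p2 : seq hedge),
      p = p1 ++ e :: hinv e :: p2.

(* L(Gam, v). Path labels are words; restricting to words in F(X) loses nothing
   in the X-regular case, see plab_freely_reduced below. *)
Definition language (v : vertex Gam) : set (free_group X) :=
  [set g | exists p : seq hedge,
      [/\ is_path v p v, reduced_path p & plab p = fword g]].

Definition x_regular : Prop :=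
  forall (v : vertex Gam) (a : letter X),
    exists! e : hedge, horg e = v /\ hlab e = a.

Definition fulfills (R : set (free_group X)) : Prop :=
  forall (v : vertex Gam) (r : free_group X), R r ->
  forall (p : seq hedge) (w : vertex Gam),
    is_path v p w -> reduced_path p -> plab p = fword r -> w = v.

Definition connected_graph : Prop :=
  forall u v : vertex Gam, exists p : seq hedge, is_path u p v.

Definition finite_graph : Prop :=
  finite_set [set: vertex Gam] /\ finite_set [set: edge Gam].

Lemma plab_freely_reduced (u v : vertex Gam) (p : seq hedge) :
  x_regular -> is_path u p v -> reduced_path p -> freely_reduced (plab p).
Proof.
move=> reg; elim: p u => [//|e p IH] u /= [_ pth] red.
have red' : reduced_path p.
  by move=> [p1 [f [p2 E]]]; apply: red; exists (e :: p1), f, p2; rewrite E.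
have {IH} := IH _ pth red'.
case: p pth red {red'} => [//|f p] /= [fe _] red.
rewrite /freely_reduced /= => ->; rewrite andbT; apply/negP => /eqP fl.
apply: red; exists [::], e, p; congr [:: _, _ & _].
have [h [_ huniq]] := reg (hter e) (linv (hlab e)).
rewrite -(huniq f) //; apply: huniq; split=> //.
by case: (e) => e0 [].
Qed.

End Graphs.

(* Main.v *)
Require Import Defs.
From mathcomp Require Import all_boot.
From mathcomp Require Import boolp classical_sets functions cardinality.

Local Open Scope classical_set_scope.

(** A closed path of [Gam] at [v] is carried by the morphism to a closed path of
    [Gam'] at [pi v] with the same label. Its label being freely reduced, the
    image path is reduced too: an edge followed by its inverse would show up as a
    cancelling pair of letters ([language_xmorphism]). So the languages are
    already nested in the free group, and [phi] preserves the inclusion.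

    That the two images are subgroups follows from the languages being
    subgroups of the free group ([language_subgroup]). Concatenating and
    reversing paths gives closure under product and inverse at the level of
    unreduced words, and free reduction of a label can be lifted to the path:
    in an X-regular graph two consecutive edges with cancelling labels are
    mutually inverse, so deleting both leaves a path with the same endpoints
    ([reads_free_reduce]). *)

Section Reading.

Set Implicit Arguments.
Unset Strict Implicit.

Variables (X : choiceType) (Gam : xgraph X).
Implicit Types (u v w : vertex Gam) (p q : seq (hedge Gam)).
Implicit Types (s t : seq (letter X)).

(** Reading arbitrary words, with no reducedness on either side, is what makes
    concatenation and reversal of paths immediate; [languageE] compares it with
    the language. *)
Definition reads u s v := exists2 p, is_path u p v & plab p = s.

Lemma is_path_cat u p q w :
  is_path u (p ++ q) w <-> exists2 v, is_path u p v & is_path v q w.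
Proof.
elim: p u => [|e p IH] u /=.
  by split=> [uqw|[v -> //]]; exists u.
split=> [[eu /IH [v pv qw]]|[v [eu pv] qw]]; first by exists v.
by split=> //; apply/IH; exists v.
Qed.

Lemma reads_cat u s v t w : reads u s v -> reads v t w -> reads u (s ++ t) w.
Proof.
move=> [p up <-] [q vq <-]; exists (p ++ q); last exact: map_cat.
by apply/is_path_cat; exists v.
Qed.

Lemma horg_hinv (e : hedge Gam) : horg (hinv e) = hter e.
Proof. by case: e => e []. Qed.

Lemma hter_hinv (e : hedge Gam) : hter (hinv e) = horg e.
Proof. by case: e => e []. Qed.

Lemma reads_winv u s v : reads u s v -> reads v (winv s) u.
Proof.
move=> [p up <-] {s}; elim: p u up => [|e p IH] u /=.
  by move=> ->; exists [::].
move=> [eu /IH vp]; rewrite /winv /= rev_cons -cats1.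
apply: reads_cat vp _; exists [:: hinv e] => //=.
by rewrite horg_hinv hter_hinv.
Qed.

(** The case [s = linv a :: _] is where X-regularity enters: [hinv e] is an edge
    with the origin and label of the one that follows [e], hence equal to it. *)
Lemma reads_push u a s v :
  x_regular Gam -> reads u (a :: s) v -> reads u (push a s) v.
Proof.
move=> reg [[|e p] //= [eu up] [ea ps]]; subst s; case: p up => [|f p] up.
  by exists [:: e]; rewrite /= ?ea.
rewrite /=; case: eqP => [fa|_]; last by exists [:: e, f & p]; rewrite /= ?ea.
case: up => fo fp.
have fE : f = hinv e.
  have [h [_ huniq]] := reg (hter e) (linv a).
  rewrite -(huniq f) //; apply: huniq.
  by rewrite horg_hinv -ea.
by exists p => //; move: fp; rewrite fE hter_hinv eu.
Qed.

Lemma reads_free_reduce u s v :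
  x_regular Gam -> reads u s v -> reads u (free_reduce s) v.
Proof.
move=> reg; elim: s u => //= a s IH u [[|e p] //= [eu ep] [ea ps]].
apply: reads_push => //; have [|q eq qs] := IH (hter e); first by exists p.
by exists (e :: q) => //=; rewrite ea qs.
Qed.

(** Passing from a path to its label turns an edge followed by its inverse into
    a letter followed by its inverse. Unlike the converse
    [plab_freely_reduced], this holds in every graph. *)
Lemma freely_reduced_path p : freely_reduced (plab p) -> reduced_path p.
Proof.
move=> + [p1 [e [p2 pE]]]; rewrite pE /plab map_cat /=.
by move=> /cat_sorted2[_ /=] /andP[/eqP].
Qed.

Lemma languageE v (g : free_group X) : language v g <-> reads v (fword g) v.
Proof.
split=> [[p [vp _ pg]]|[p vp pg]]; exists p => //; split=> //.
by apply: freely_reduced_path; rewrite pg; exact: valP.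
Qed.

Lemma language_subgroup v : x_regular Gam -> subgroup (language v).
Proof.
move=> reg; split=> [|g h]; rewrite !in_setE.
  by apply/languageE; exists [::].
move=> /languageE vg /languageE vh; apply/languageE.
by apply: reads_free_reduce (reads_cat vg (reads_winv vh)).
Qed.

End Reading.

Lemma reads_xmorphism (X : choiceType) (Gam Gam' : xgraph X)
    (pi : xmorphism Gam Gam') (u v : vertex Gam) s :
  reads u s v -> reads (pi u) s (pi v).
Proof.
move=> [p up <-] {s}; exists [seq (emap pi e.1, e.2) | e <- p]; last first.
  by rewrite /plab -map_comp; apply: eq_map => e; rewrite /hlab /= emap_lab.
elim: p u up => [|[e b] p IH] u /=; first by move->.
move=> [<- /IH]; rewrite /horg /hter /=.
by case: b; rewrite emap_org emap_ter.
Qed.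

Lemma language_xmorphism (X : choiceType) (Gam Gam' : xgraph X)
    (pi : xmorphism Gam Gam') (v : vertex Gam) :
  language v `<=` language (pi v).
Proof. by move=> g /languageE/reads_xmorphism/languageE; apply. Qed.

Lemma image_subgroup (G H : groupType) (f : {multiplicative G -> H})
    (A : set G) : subgroup A -> subgroup (f @` A).
Proof.
move=> [A1 AV].
have f1 : f 1%g = 1%g by apply: (mulgI (f 1%g)); rewrite -gmulfM !mulg1.
have fV x : f x^-1%g = (f x)^-1%g.
  by apply: (mulgI (f x)); rewrite -gmulfM !mulgV f1.
split=> [|x y]; rewrite !in_setE.
  by exists 1%g => //; rewrite in_setE in A1.
move=> [a Aa <-] [b Ab <-]; exists (a / b)%g; last by rewrite gmulfM fV.
by have := AV a b; rewrite !in_setE; apply.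
Qed.

Theorem proposition4p3 (X : finType) (R : set (free_group X))
    (G : groupType) (phi : {multiplicative free_group X -> G})
    (hG : presentation R phi)
    (Gam Gam' : xgraph X) (pi : xmorphism Gam Gam')
    (v : vertex Gam) (v' : vertex Gam') (hv : v' = pi v)
    (conn : connected_graph Gam) (conn' : connected_graph Gam')
    (fin : finite_graph Gam) (fin' : finite_graph Gam')
    (reg : x_regular Gam) (reg' : x_regular Gam')
    (ful : fulfills Gam R) (ful' : fulfills Gam' R) :
  let K := language v in
  let H := language v' in
  [/\ subgroup (phi @` K), subgroup (phi @` H) & phi @` K `<=` phi @` H].
Proof.
move=> K H; split; [exact/image_subgroup/language_subgroup..|].
by rewrite /H hv; apply/image_subset/language_xmorphism.
Qed.
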